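(* Let $n\ge3$. There exists a quasi-metric $\rho$ on $[n]$ such that the Kantorovich-Rubinstein polytope $$KR(\rho)=\mathrm{Conv}\Big\{\frac{e_i-e_j}{\rho(i,j)}:1\le i\neq j\le n\Big\}$$ is affinely isomorphic to the polar dual $W_n^\circ$ of the cyclohedron $W_n$. Moreover $\rho$ satisfies the strict triangle inequality $\rho(i,k)<\rho(i,j)+\rho(j,k)$ whenever $i,j,k$ are pairwise distinct.
   Context: A quasi-metric on a finite set $X$ is $\rho:X\times X\to\mathbb{R}_{\ge0}$ with $\rho(x,y)=0\iff x=y$ and $\rho(x,z)\le\rho(x,y)+\rho(y,z)$; symmetry is not required. Realization of the cyclohedron: let $\mathrm{Con}(C_n)$ be the family consisting of $[n]$ and all nonempty proper cyclic intervals $\{i,i+1,\dots,j\}$ of $[n]$ (indices mod $n$), $\Delta_X=\mathrm{Conv}\{e_i:i\in X\}$, and $W_n=\sum_{X\in\mathrm{Con}(C_n)}\Delta_X\subset\{x:\sum x_i=N\}$, $N=|\mathrm{Con}(C_n)|=n^2-n+1$. Translate $W_n$ by $-\frac Nn(1,\dots,1)$ into $H_0=\{x:\sum x_i=0\}$ (the origin then lies in its relative interior) and let $W_n^\circ=\{y\in H_0:\langle y,x\rangle\le 1 \text{ for all } x \text{ in the translate}\}$ be its polar inside $H_0$. *)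

(* Defs.v *)
From HB Require Import structures.
From mathcomp Require Import all_boot all_order all_algebra.
Set Implicit Arguments. Unset Strict Implicit. Unset Printing Implicit Defensive.
Import Order.TTheory GRing.Theory Num.Theory.
Local Open Scope ring_scope.

Definition quasi_metric (R : realFieldType) (n : nat) (rho : 'I_n -> 'I_n -> R) : Prop :=
  (forall x y, 0 <= rho x y) /\
  (forall x y, rho x y = 0 <-> x = y) /\
  (forall x y z, rho x z <= rho x y + rho y z).

Definition evec (R : realFieldType) (n : nat) (i : 'I_n) : 'rV[R]_n := delta_mx 0 i.

Definition conv_fam (R : realFieldType) (n : nat) (I : finType) (P : pred I)
    (v : I -> 'rV[R]_n) (x : 'rV[R]_n) : Prop :=
  exists w : I -> R, (forall i, P i -> 0 <= w i) /\
    \sum_(i | P i) w i = 1 /\ x = \sum_(i | P i) w i *: v i.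

Definition KR (R : realFieldType) (n : nat) (rho : 'I_n -> 'I_n -> R) (x : 'rV[R]_n) : Prop :=
  conv_fam (fun p : 'I_n * 'I_n => p.1 != p.2)
    (fun p => (rho p.1 p.2)^-1 *: (evec R p.1 - evec R p.2)) x.

(* nonempty proper cyclic interval {i, i+1, ..., i+k-1} (mod n), 1 <= k <= n-1 *)
Definition cyclic_interval (n : nat) (A : {set 'I_n}) : bool :=
  [exists i : 'I_n, exists k : 'I_n,
     (0 < k)%N && (A == [set j : 'I_n | ((j + n - i) %% n < k)%N])].

Definition Con (n : nat) : {set {set 'I_n}} :=
  [set A | (A == setT) || cyclic_interval A].

Definition simplex (R : realFieldType) (n : nat) (X : {set 'I_n}) (x : 'rV[R]_n) : Prop :=
  conv_fam (mem X) (@evec R n) x.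

Definition cyclohedron (R : realFieldType) (n : nat) (x : 'rV[R]_n) : Prop :=
  exists p : {set 'I_n} -> 'rV[R]_n,
    (forall X, X \in Con n -> simplex X (p X)) /\ x = \sum_(X in Con n) p X.

Definition cyclohedron_centered (R : realFieldType) (n : nat) (x : 'rV[R]_n) : Prop :=
  cyclohedron (x + ((#|Con n|)%:R / n%:R) *: const_mx 1).

Definition dotv (R : realFieldType) (n : nat) (y x : 'rV[R]_n) : R :=
  \sum_(i < n) y 0 i * x 0 i.

Definition cyclohedron_polar (R : realFieldType) (n : nat) (y : 'rV[R]_n) : Prop :=
  \sum_(i < n) y 0 i = 0 /\
  (forall x, cyclohedron_centered x -> dotv y x <= 1).

Definition affine_map (R : realFieldType) (n : nat) (f : 'rV[R]_n -> 'rV[R]_n) : Prop :=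
  exists (M : 'M[R]_n) (b : 'rV[R]_n), forall x, f x = x *m M + b.

(* A and B are affinely isomorphic: affine maps f, g with f(A) in B, g(B) in A,
   mutually inverse on A and B (hence an affine isomorphism aff(A) ~ aff(B)
   carrying A onto B). *)
Definition affinely_isomorphic (R : realFieldType) (n : nat)
    (A B : 'rV[R]_n -> Prop) : Prop :=
  exists f g : 'rV[R]_n -> 'rV[R]_n,
    affine_map f /\ affine_map g /\
    (forall x, A x -> B (f x)) /\ (forall y, B y -> A (g y)) /\
    (forall x, A x -> g (f x) = x) /\ (forall y, B y -> f (g y) = y).

(* Main.v *)
Require Import Defs.
From HB Require Import structures.
From mathcomp Require Import all_boot all_order all_algebra.
From mathcomp Require Import zify ring lra.
Import Order.TTheory GRing.Theory Num.Theory.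
Local Open Scope ring_scope.

(** The support function of the cyclohedron is h(y) = sum over X in Con(C_n) of
    max_X y, and the normals of its facets are -1_A for A a proper cyclic
    interval.  On the root side, the linear map sending e_(i+1) - e_i to
    e_i - (1/n)(1,...,1) sends e_i - e_j to the projection of -1_[i,j) to H_0,
    where [i,j) is the cyclic interval from i to j-1.  Hence one takes
    rho(i,j) = h(proj(-1_[i,j))) = (N/n) k - k(k+1)/2 with k = j - i mod n, and
    the strict triangle inequality is a computation.  That the points
    proj(-1_[i,j))/rho(i,j) have the whole polar as convex hull follows by writing
    max y - y as a nonnegative combination of the 1_[i,j), peeling connected
    components off its support; along this decomposition min_X is additive for
    every X in Con(C_n). *)

(** * Cyclic intervals: inclusion, encoding by endpoints, counting *)

(* The cyclic interval {i, ..., j-1}; empty for i = j. *)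
Definition carc m (i j : 'I_m.+3) : {set 'I_m.+3} :=
  [set t : 'I_m.+3 | ((t - i)%R < (j - i)%R)%N].

Arguments carc {m} i j.

Lemma val_subI {m} (x y : 'I_m.+3) :
  (x - y)%R = (if y <= x then x - y else x + m.+3 - y)%N :> nat.
Proof.
have xn := ltn_ord x; have yn := ltn_ord y.
rewrite /= modnDmr; case: leqP => [yx|xy].
  by rewrite addnBA 1?ltnW // addnC -addnBA // modnDl modn_small //; lia.
by rewrite addnBA 1?ltnW // modn_small //; lia.
Qed.

Lemma modn_subI {m} (t i : 'I_m.+3) : ((t + m.+3 - i) %% m.+3)%N = (t - i)%R.
Proof. by rewrite /= modnDmr addnBA // ltnW. Qed.

Lemma val_addI1 {m} (x : 'I_m.+3) :
  (x + 1)%R = (if x.+1 == m.+3 then 0 else x.+1)%N :> nat.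
Proof.
have xn := ltn_ord x; rewrite /= modnDmr addn1.
by case: eqP => [->|?]; rewrite ?modnn // modn_small //; lia.
Qed.

Lemma mem_arc {m} (i j t : 'I_m.+3) :
  (t \in carc i j) = ((t - i)%R < (j - i)%R)%N.
Proof. by rewrite inE. Qed.

Lemma mem_arcB {m} (i j t s : 'I_m.+3) :
  (t - s \in carc (i - s) (j - s)) = (t \in carc i j).
Proof. by rewrite !mem_arc !opprB !addrA !subrK. Qed.

Lemma card_arc {m} (i j : 'I_m.+3) : #|carc i j| = (j - i)%R.
Proof.
rewrite -(card_imset _ (addIr (- i))).
have -> : [set t - i | t in carc i j] = [set t : 'I_m.+3 | (t < (j - i)%R)%N].
  apply/setP => t; rewrite inE; apply/imsetP/idP => [[s]|tlt].
    by rewrite mem_arc => ? ->.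
  by exists (t + i); rewrite ?addrK // mem_arc addrK.
set k := (j - i)%R; rewrite cardsE -sum1_card.
rewrite (eq_bigl (fun t : 'I_m.+3 => (t < k)%N)) //.
by rewrite -(big_ord_widen _ (fun=> 1%N)) 1?ltnW // sum1_card card_ord.
Qed.

(** Translation by [-i] turns the larger interval into an initial segment [0,k) with k < n. Since it
    misses n-1, an interval inside it cannot wrap around, and only the positions of its two ends
    matter. *)
Lemma arc_sub {m} (a b i j : 'I_m.+3) : a != b ->
  (carc a b \subset carc i j) = ((a - i)%R < (b - i)%R <= (j - i)%R)%N.
Proof.
move=> ab.
have: a - i != b - i by rewrite (inj_eq (addIr (- i))).
have -> : (carc a b \subset carc i j) =
    [forall t, (t \in carc (a - i) (b - i)) ==> (t < (j - i)%R)%N].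
  apply/subsetP/forallP => [sub t|sub t].
    apply/implyP; rewrite -{1}(addrK i t) mem_arcB => /sub.
    by rewrite mem_arc addrK.
  by rewrite -(mem_arcB _ _ _ i) [t \in carc i j]mem_arc => /(implyP (sub (t - i))).
move: (a - i) (b - i) (j - i) => {ab}{}a {}b k ab.
have an := ltn_ord a; have bn := ltn_ord b; have kn := ltn_ord k.
have {}ab : nat_of_ord a <> b by move=> /val_inj/eqP; apply/negP.
apply/forallP/idP => [sub|abk t].
  case: (ltnP a b) => [lab|lba].
    (* The last element b-1 of the interval forces b <= k; in the wrapping case below, the interval
       contains n-1, which [0,k) does not. *)
    have pb : (b.-1 < m.+3)%N by lia.
    have := sub (Ordinal pb); rewrite mem_arc !val_subI /=.
    have -> : (a <= b.-1)%N by lia.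
    rewrite (ltnW lab); lia.
  have := sub ord_max; rewrite mem_arc !val_subI /=.
  have -> : (a <= m.+2)%N by lia.
  have -> : (a <= b)%N = false by lia.
  lia.
have tn := ltn_ord t; rewrite mem_arc !val_subI.
have -> : (a <= b)%N by lia.
by apply/implyP; case: (leqP a t); lia.
Qed.

(** Equal intervals have equal lengths, and inclusion of the second in the first places c at some
    offset from a with d still within reach of b. Equal lengths then force the offset to be 0. *)
Lemma arc_inj {m} : {in [set p : 'I_m.+3 * 'I_m.+3 | p.1 != p.2] &,
  injective (fun p => carc p.1 p.2)}.
Proof.
move=> [a b] [c d]; rewrite !inE /= => ab cd e.
have := subxx (carc a b); rewrite {1}e arc_sub // => h.
have := f_equal (fun A : {set _} => #|A|) e; rewrite !card_arc => ebc.
have e1 : d - c = (d - a) - (c - a) by rewrite opprB addrA subrK.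
have [/ltnW h1 h2] := andP h.
have := val_subI (d - a) (c - a); rewrite -e1 -ebc h1 => h3.
have /eqP : c - a = 0.
  apply: val_inj; change (nat_of_ord (c - a) = 0%N); move: h1 h2 h3.
  by move: (nat_of_ord (c - a)) (nat_of_ord (d - a)) (nat_of_ord (b - a)) => x y z; lia.
rewrite subr_eq0 => /eqP ca; rewrite ca in ebc *; congr (_, _).
by apply: (addIr (- a)); apply: val_inj; rewrite /= in ebc *; rewrite ebc.
Qed.

Lemma arc_neqT {m} (i j : 'I_m.+3) : carc i j != setT.
Proof.
apply/eqP => /(f_equal (fun A : {set _} => #|A|)).
by rewrite card_arc cardsT card_ord => e; have := ltn_ord (j - i); rewrite e ltnn.
Qed.

(** A base point i and a length 0 < k < n amount to the endpoints (i, i+k), which are distinct.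
    Proper cyclic intervals are thus indexed by the same pairs as the generators of [KR]. *)
Lemma Con_arc m :
  Con m.+3 = setT |: [set carc p.1 p.2 | p in [set p : 'I_m.+3 * 'I_m.+3 | p.1 != p.2]].
Proof.
apply/setP => A; rewrite !inE; congr orb.
apply/existsP/imsetP => [[i /existsP[k /andP[k0 /eqP->]]]|[[i j]]].
  exists (i, i + k); first rewrite inE /=.
    apply: contraTneq k0 => e; suff -> : k = 0 by [].
    by apply: (addrI i); rewrite -e addr0.
  have ik : i + k - i = k by rewrite addrAC subrr add0r.
  apply/setP => t; rewrite inE mem_arc ik.
  by rewrite modn_subI.
rewrite inE /= => ij ->; exists i; apply/existsP; exists (j - i).
apply/andP; split.
  rewrite lt0n; apply: contraNneq ij => e.
  have /eqP : j - i = 0 by apply: val_inj.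
  by rewrite subr_eq0 eq_sym.
by apply/eqP/setP => t; rewrite mem_arc inE modn_subI.
Qed.

Lemma card_offdiag m : #|[set p : 'I_m.+3 * 'I_m.+3 | p.1 != p.2]| = (m.+3 * m.+2)%N.
Proof.
rewrite -sum1_card (eq_bigl (fun p => p.1 != p.2)); last by move=> p; rewrite inE.
rewrite -(pair_big_dep xpredT (fun i j => i != j) (fun _ _ => 1%N)) /=.
under eq_bigr => i _.
  have -> : (\sum_(j | i != j) 1 = m.+2)%N; last over.
  by rewrite sum1_card (eq_card (B := predC1 i)) ?cardC1 ?card_ord // => j; rewrite !inE eq_sym.
by rewrite sum_nat_const card_ord.
Qed.

Lemma card_Con m : #|Con m.+3| = (m.+3 * m.+2).+1.
Proof.
rewrite Con_arc cardsU1 card_in_imset ?card_offdiag; last exact: arc_inj.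
suff -> : setT \notin [set carc p.1 p.2 | p in [set p : 'I_m.+3 * 'I_m.+3 | p.1 != p.2]] by [].
by apply/imsetP => [[p _ /esym/eqP]]; apply/negP/arc_neqT.
Qed.

(** With k the length of [i,j), the intervals inside it correspond, after translation by [-i], to
    pairs 0 <= a < b <= k, that is, to the 2-subsets of a set of k+1 elements. The whole set is not
    counted, since [i,j) is proper. *)
Lemma card_Con_sub m (i j : 'I_m.+3) :
  #|[set X in Con m.+3 | X \subset carc i j]| = 'C((j - i)%R.+1, 2).
Proof.
have -> : [set X in Con m.+3 | X \subset carc i j] = [set carc p.1 p.2 | p in
   [set p : 'I_m.+3 * 'I_m.+3 | ((p.1 - i)%R < (p.2 - i)%R <= (j - i)%R)%N]].
  apply/setP => X; rewrite inE Con_arc !inE; apply/andP/imsetP => [[]|[p]].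
    case/orP => [/eqP->|/imsetP[p]].
      by rewrite subTset (negbTE (arc_neqT _ _)).
    by rewrite inE => pp ->; rewrite arc_sub // => h; exists p; rewrite ?inE.
  rewrite inE => h ->.
  have pp : p.1 != p.2 by apply: contraTneq h => ->; rewrite ltnn.
  rewrite arc_sub // h; split=> //; apply/orP; right; apply/imsetP; exists p => //.
  by rewrite inE.
rewrite card_in_imset; last first.
  move=> p q; rewrite !inE => hp hq; apply: arc_inj; rewrite inE.
    by apply: contraTneq hp => ->; rewrite ltnn.
  by apply: contraTneq hq => ->; rewrite ltnn.
rewrite -sum1_card; move: (j - i) => k.
rewrite (eq_bigl (fun p : 'I_m.+3 * 'I_m.+3 => ((p.2 - i)%R <= k) && ((p.1 - i)%R < (p.2 - i)%R))%N);
  last by move=> p; rewrite inE andbC.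
(* Besides translating by [i], the reindexing swaps the endpoints, so that the outer sum runs over
   the end b and the inner one counts the b starts below it. *)
rewrite (reindex (fun p : 'I_m.+3 * 'I_m.+3 => (p.2 + i, p.1 + i))); last first.
  by exists (fun p => (p.2 - i, p.1 - i)) => p _ /=; rewrite ?addrK ?subrK -surjective_pairing.
rewrite (eq_bigl (fun p : 'I_m.+3 * 'I_m.+3 => (p.1 <= k) && (p.2 < p.1))%N); last first.
  by move=> p; rewrite -[(_, _).2]/(p.1 + i) -[(_, _).1]/(p.2 + i) !addrK.
rewrite -(pair_big_dep (fun b : 'I_m.+3 => b <= k)%N (fun b a : 'I_m.+3 => a < b)%N (fun _ _ => 1%N)) /=.
under eq_bigr => b _.
  rewrite -(big_ord_widen _ (fun=> 1%N)) 1?ltnW // sum1_card card_ord; over.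
rewrite (eq_bigl (fun b : 'I_m.+3 => (b < k.+1)%N)) // -(big_ord_widen _ (fun b => b)) //.
by rewrite -(big_mkord xpredT (fun b => b)) bin2_sum.
Qed.

(** * Connectedness and decomposition into cyclic intervals *)

Lemma val_subI1 {m} (x : 'I_m.+3) : x != 0 -> (x - 1)%R = x.-1 :> nat.
Proof.
move=> x0; have := val_addI1 (x - 1); rewrite subrK; case: ifP => _ e; last by rewrite e.
by move/eqP: x0; case; apply: val_inj.
Qed.

Lemma arc_start {m} (a b : 'I_m.+3) : (a \in carc a b) = (a != b).
Proof.
by rewrite mem_arc subrr eq_sym -subr_eq0 -(inj_eq val_inj) /= -lt0n.
Qed.

Lemma Con_nonempty {m} {X : {set 'I_m.+3}} : X \in Con m.+3 -> exists t, t \in X.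
Proof.
rewrite Con_arc !inE => /orP[/eqP->|/imsetP[p]]; first by exists ord0.
by rewrite inE => pp ->; exists p.1; rewrite arc_start.
Qed.

(** A property unchanged by each successor step inside the interval spreads from [a], by induction
    on the distance from [a]. *)
Lemma arc_connected {m} (P : pred 'I_m.+3) (a b : 'I_m.+3) :
  (forall t, t \in carc a b -> t + 1 \in carc a b -> P t = P (t + 1)) ->
  {in carc a b, forall t, P t = P a}.
Proof.
move=> h t; move e: (nat_of_ord (t - a)) => k.
elim: k => [|k IH] in t e *.
  by move=> _; congr P; apply/eqP; rewrite -subr_eq0; apply/eqP/val_inj.
move=> tab.
have e' : nat_of_ord (t - 1 - a) = k.
  by rewrite addrAC val_subI1 ?e //; apply: contra_eq_neq e => ->.
have t'ab : t - 1 \in carc a b.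
  by rewrite mem_arc e' ltnW // -e -mem_arc.
by rewrite -(IH (t - 1)) // [RHS]h ?subrK.
Qed.

Lemma arc_component {m} {S : {set 'I_m.+3}} : S != set0 -> S != setT ->
  exists i j, [/\ i != j, carc i j \subset S &
    forall X, X \in Con m.+3 -> X \subset S ->
      (X \subset carc i j) || [disjoint X & carc i j]].
Proof.
move=> /set0Pn[c cS]; rewrite -subTset => /subsetPn[a _ aS].
(* [i] is the first element of [S] met after [a], so [i - 1] is outside [S]; [j] is the first
   element outside [S] met after [i]. *)
pose i := [arg min_(i < c in S) ((i - a)%R : 'I_m.+3)].
have [iS imin] : i \in S /\ forall x, x \in S -> ((i - a)%R <= (x - a)%R)%N.
  by rewrite /i; case: arg_minnP.
pose j := [arg min_(j < a in ~: S) ((j - i)%R : 'I_m.+3)].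
have [jS jmin] : j \notin S /\ forall x, x \notin S -> ((j - i)%R <= (x - i)%R)%N.
  rewrite /j; case: arg_minnP; first by rewrite inE.
  by move=> k; rewrite inE => kS kmin; split=> // x xS; apply: kmin; rewrite inE.
have ij : i != j by apply: contraNneq jS => <-.
have sub t : t \in carc i j -> t \in S.
  by rewrite mem_arc; apply: contraTT => /jmin; rewrite -leqNgt.
have i1S : i - 1 \notin S.
  have ia : i - a != 0 by rewrite subr_eq0; apply: contraNneq aS => <-.
  apply/negP => /imin; rewrite addrAC val_subI1 //.
  suff : nat_of_ord (i - a) <> 0%N by case: (nat_of_ord (i - a)) => // ? _; rewrite ltnn.
  by move=> e; move/eqP: ia; apply; apply: val_inj.
exists i, j; split=> //; first by apply/subsetP.
move=> X; rewrite Con_arc !inE => /orP[/eqP->|/imsetP[p]].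
  by rewrite subTset => /eqP ST; rewrite ST inE in aS.
rewrite inE => pp -> XS.
(* Membership in [i,j) changes from t to t+1 only if t+1 is [i] or [j], and then t or t+1 lies
   outside [S]. *)
have key t : t \in S -> t + 1 \in S -> (t \in carc i j) = (t + 1 \in carc i j).
  move=> tS t1S; have ti := ltn_ord (j - i).
  have tj : t + 1 != j by apply: contraNneq jS => <-.
  have t1i : t + 1 - i != 0.
    rewrite subr_eq0; apply: contraNneq i1S => <-.
    by rewrite addrK.
  have : nat_of_ord (t + 1 - i) <> 0%N by move=> e; move/eqP: t1i; apply; apply: val_inj.
  have : nat_of_ord (t + 1 - i) <> nat_of_ord (j - i).
    by move/val_inj/(addIr (- i))/eqP; apply/negP.
  rewrite !mem_arc addrAC val_addI1; case: eqP; first by [].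
  by move: ti; move: (nat_of_ord (t - i)) (nat_of_ord (j - i)) => x y; lia.
have con := @arc_connected m (mem (carc i j)) p.1 p.2.
have {}con : {in carc p.1 p.2, forall t, (t \in carc i j) = (p.1 \in carc i j)}.
  by apply: con => t tX t1X; apply: key; apply: (subsetP XS).
case pA: (p.1 \in carc i j) con => con; apply/orP; [left|right].
  by apply/subsetP => t /con.
by apply/pred0P => t /=; apply/andP => [[/con ->]].
Qed.

(** Induction on the size of the support: subtracting the minimum of [z] over a component of the
    support kills a point of it. The last clause says that the minimum over X is additive along the
    decomposition: the sum on the right is a lower bound for [z] on X, and [s] attains it. *)
Lemma arc_decomposition {R : realFieldType} {m} (z : 'I_m.+3 -> R) :
  (forall i, 0 <= z i) -> (exists a, z a = 0) ->
  exists w : 'I_m.+3 * 'I_m.+3 -> R, [/\ forall p, 0 <= w p,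
    forall t, z t = \sum_p w p * (t \in carc p.1 p.2)%:R &
    forall X, X \in Con m.+3 -> exists2 s, s \in X &
      z s = \sum_p w p * (X \subset carc p.1 p.2)%:R].
Proof.
move=> z0 [a za]; move e: #|[set t | z t != 0]| => k.
elim/ltn_ind: k z z0 za e => k IH z z0 za e.
have [S0|Sn0] := eqVneq [set t | z t != 0] set0.
  have zE t : z t = 0.
    by apply/eqP; have := in_set0 t; rewrite -S0 inE => /negbFE.
  exists (fun=> 0); split=> // [t|X XC].
    by rewrite zE big1 // => p _; rewrite mul0r.
  have [s sX] := Con_nonempty XC; exists s => //.
  by rewrite zE big1 // => p _; rewrite mul0r.
have SnT : [set t | z t != 0] != setT.
  by apply/eqP => /setP/(_ a); rewrite !inE za eqxx.
have [i [j [ij AS comp]]] := arc_component Sn0 SnT.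
have iA : i \in carc i j by rewrite arc_start.
have [b bA bmin] : exists2 b, b \in carc i j & forall t, t \in carc i j -> z b <= z t.
  by case: (arg_minP z iA) => b ? ?; exists b.
pose z' t := z t - z b * (t \in carc i j)%:R.
have z'0 t : 0 <= z' t.
  by rewrite /z' subr_ge0; case: (boolP (t \in _)) => [/bmin|_]; rewrite ?mulr1 ?mulr0.
have aA : a \notin carc i j.
  by apply/negP => /(subsetP AS); rewrite inE za eqxx.
have z'a : z' a = 0 by rewrite /z' za (negbTE aA) mulr0 subr0.
have lt : (#|[set t | z' t != 0]%R| < k)%N.
  rewrite -e; apply: proper_card; apply/properP; split.
    apply/subsetP => t; rewrite !inE; apply: contraNneq => zt.
    have tA : t \notin carc i j by apply/negP => /(subsetP AS); rewrite inE zt eqxx.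
    by rewrite /z' zt (negbTE tA) mulr0 subr0.
  exists b; first by rewrite (subsetP AS).
  by rewrite inE /z' bA mulr1 subrr eqxx.
have [w' [w'0 w't w'X]] := IH _ lt z' z'0 z'a erefl.
pose w p := w' p + z b * (p == (i, j))%:R.
have wE (F : pred ('I_m.+3 * 'I_m.+3)) : \sum_p w p * (F p)%:R =
    \sum_p w' p * (F p)%:R + z b * (F (i, j))%:R.
  rewrite (eq_bigr (fun p => w' p * (F p)%:R + z b * (p == (i, j))%:R * (F p)%:R)).
    rewrite big_split /= [X in _ + X](bigD1 (i, j)) //= eqxx mulr1.
    by rewrite [X in _ + (_ + X)]big1 ?addr0 // => p /negbTE->; rewrite mulr0 mul0r.
  by move=> p _; rewrite mulrDl.
have w0 p : 0 <= w p by rewrite addr_ge0 ?mulr_ge0 ?ler0n.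
have wt t : z t = \sum_p w p * (t \in carc p.1 p.2)%:R.
  by rewrite (wE (fun p => t \in carc p.1 p.2)) -w't /z' subrK.
exists w; split=> // X XC.
(* If [z] vanishes at some [s] in X, the sum lies between 0 and [z s] = 0. *)
case: (boolP [exists t in X, z t == 0]) => [/existsP[s /andP[sX /eqP zs]]|zX].
  exists s => //; apply/eqP; rewrite zs eq_le; apply/andP; split.
    by apply: sumr_ge0 => p _; rewrite mulr_ge0 ?ler0n.
  rewrite -[leRHS]zs wt ler_sum // => p _; apply: ler_wpM2l => //.
  by case: (boolP (X \subset _)) => [/subsetP->|]; rewrite ?ler0n.
have XS : X \subset [set t | z t != 0].
  apply/subsetP => t tX; rewrite inE; apply: contraNneq zX => zt.
  by apply/existsP; exists t; rewrite tX zt eqxx.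
have [s sX z's] := w'X X XC; exists s => //.
rewrite (wE (fun p => X \subset carc p.1 p.2)) -z's /z'.
(* Otherwise X lies in the support, hence inside the component or disjoint from it. So [z] and [z']
   differ by a constant on X, and the same [s] works for both. *)
case/orP: (comp X XC XS) => [XA|XA].
  by rewrite XA (subsetP XA) // subrK.
have sA : s \notin carc i j.
  by apply/negP => sA; move/pred0P/(_ s): XA; rewrite /= sX sA.
have -> : X \subset carc i j = false by apply/negP => /subsetP/(_ s sX); apply/negP.
by rewrite (negbTE sA) mulr0 subr0 addr0.
Qed.

(** * The distance as a function of interval length *)

(** The coefficient n - 1 + 1/n is N/n for N = n^2 - n + 1. *)
Definition cost (R : realFieldType) (n k : nat) : R :=
  (n%:R - 1 + n%:R^-1) * k%:R - k%:R * (k%:R + 1) / 2.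

Lemma natr_bin2 {R : realFieldType} (k : nat) : 'C(k.+1, 2)%:R = k%:R * (k%:R + 1) / 2 :> R.
Proof.
elim: k => [|k IH]; first by rewrite mul0r mul0r.
by rewrite binS bin1 natrD IH -natr1; field.
Qed.

Lemma cost0 {R : realFieldType} (n : nat) : cost R n 0 = 0.
Proof. by rewrite /cost mulr0 mul0r mul0r subrr. Qed.

Lemma cost_gt0 {R : realFieldType} (n k : nat) : (0 < k < n)%N -> 0 < cost R n k.
Proof.
move=> /andP[k0 kn].
have -> : cost R n k = k%:R * (n%:R - 1 + n%:R^-1 - (k%:R + 1) / 2).
  by rewrite /cost; ring.
have n0 : 0 < (n%:R : R)^-1 by rewrite invr_gt0 ltr0n; lia.
have k0' : 1 <= k%:R :> R by rewrite ler1n.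
have : k%:R + 1 <= n%:R :> R by rewrite natr1 ler_nat.
by move=> kn'; rewrite mulr_gt0 ?ltr0n //; lra.
Qed.

(** The linear terms cancel, and the quadratic term leaves the defect kl. *)
Lemma cost_add {R : realFieldType} (n k l : nat) : (0 < k)%N -> (0 < l)%N ->
  cost R n (k + l) < cost R n k + cost R n l.
Proof.
move=> k0 l0; have kl : 0 < (k%:R * l%:R : R) by rewrite mulr_gt0 ?ltr0n.
rewrite -subr_gt0.
have -> : cost R n k + cost R n l - cost R n (k + l) = k%:R * l%:R.
  by rewrite /cost natrD; move: (n%:R^-1) => v; field.
exact: kl.
Qed.

Lemma cost_wrap {R : realFieldType} (n k l : nat) : (2 < n)%N -> (k < n)%N -> (l < n)%N ->
  (n <= k + l)%N -> cost R n (k + l - n) < cost R n k + cost R n l.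
Proof.
move=> n2 kn ln nkl.
have n0 : n%:R != 0 :> R by rewrite pnatr_eq0; lia.
rewrite -subr_gt0.
have -> : cost R n k + cost R n l - cost R n (k + l - n) =
    (n%:R - 1) * (n%:R - 2) / 2 + (n%:R - k%:R) * (n%:R - l%:R).
  by rewrite /cost natrB // natrD; field.
have n3 : 3 <= n%:R :> R by rewrite ler_nat.
have kn' : 0 < n%:R - k%:R :> R by rewrite subr_gt0 ltr_nat.
have ln' : 0 < n%:R - l%:R :> R by rewrite subr_gt0 ltr_nat.
by rewrite addr_gt0 ?mulr_gt0 //; lra.
Qed.

(* The value at the projection of -1_[i,j) of the support function of the
   centered cyclohedron. *)
Definition rhoC (R : realFieldType) m (i j : 'I_m.+3) : R :=
  (#|Con m.+3|)%:R / m.+3%:R * #|carc i j|%:R - #|[set X in Con m.+3 | X \subset carc i j]|%:R.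

Lemma rhoC_cost {R : realFieldType} {m} (i j : 'I_m.+3) :
  rhoC R m i j = cost R m.+3 (j - i)%R.
Proof.
rewrite /rhoC card_arc card_Con card_Con_sub natr_bin2 /cost; congr (_ * _ - _).
rewrite -natr1 natrM -[m.+3%:R]natr1.
have : m.+2%:R + 1 != 0 :> R by rewrite natr1 pnatr_eq0.
by move: (m.+2%:R) => v hv; field.
Qed.

Lemma rhoC_diag {R : realFieldType} {m} (i : 'I_m.+3) : rhoC R m i i = 0.
Proof. by rewrite rhoC_cost subrr cost0. Qed.

Lemma rhoC_gt0 {R : realFieldType} {m} (i j : 'I_m.+3) : i != j -> 0 < rhoC R m i j.
Proof.
by move=> ij; rewrite rhoC_cost cost_gt0 // ltn_ord andbT -card_arc card_gt0;
  apply/set0Pn; exists i; rewrite arc_start.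
Qed.

Lemma rhoC_ge0 {R : realFieldType} {m} (i j : 'I_m.+3) : 0 <= rhoC R m i j.
Proof. by have [->|/rhoC_gt0/ltW//] := eqVneq i j; rewrite rhoC_diag. Qed.

Lemma rhoC_triangle {R : realFieldType} {m} (i j k : 'I_m.+3) : i != j -> j != k ->
  rhoC R m i k < rhoC R m i j + rhoC R m j k.
Proof.
move=> ij jk; rewrite !rhoC_cost.
have := ij; rewrite -arc_start mem_arc subrr => x0.
have := jk; rewrite -arc_start mem_arc subrr => y0.
have -> : k - i = (j - i) + (k - j) by rewrite [RHS]addrC addrA subrK.
move: (j - i) (k - j) x0 y0 => x y x0 y0.
have xn := ltn_ord x; have yn := ltn_ord y.
(* The two lengths either add up exactly or, when the intervals together go around the cycle, lose
   n. *)
have [xy|xy] := ltnP (x + y)%N m.+3.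
  have -> : nat_of_ord (x + y) = (x + y)%N by rewrite /= modn_small.
  exact: cost_add.
have -> : nat_of_ord (x + y) = (x + y - m.+3)%N.
  by rewrite /= -{1}(subnK xy) modnDr modn_small //; lia.
exact: cost_wrap.
Qed.

Lemma rhoC_quasi_metric (R : realFieldType) m : quasi_metric (rhoC R m).
Proof.
split; first exact: rhoC_ge0.
split=> [x y|x y z].
  split=> [e|->]; last exact: rhoC_diag.
  by have [//|/rhoC_gt0 h] := eqVneq x y; have := h R; rewrite e ltxx.
have [->|xy] := eqVneq x y; first by rewrite rhoC_diag add0r.
have [->|yz] := eqVneq y z; first by rewrite rhoC_diag addr0.
exact/ltW/rhoC_triangle.
Qed.

(** * The linear isomorphism and its inverse *)

(** Row t is the projection to H_0 of the indicator of the initial segment [0,t). *)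
Definition arcmx (R : realFieldType) m : 'M[R]_m.+3 :=
  \matrix_(t, s) ((s < t)%N%:R - t%:R / m.+3%:R).

(** The cyclic difference operator, which undoes the partial sums encoded by [arcmx]. *)
Definition succmx (R : realFieldType) m : 'M[R]_m.+3 :=
  \matrix_(s, t) ((t == s + 1)%:R - (t == s)%:R).

(** For i <= j, subtracting the indicators of two initial segments leaves minus that of [i,j). For j
    < i it leaves the indicator of the complement [j,i), and the extra constant 1 disappears under
    the projection. *)
Lemma evecB_arcmx (R : realFieldType) m (i j : 'I_m.+3) :
  (evec R i - evec R j) *m arcmx R m =
  \row_s (#|carc i j|%:R / m.+3%:R - (s \in carc i j)%:R).
Proof.
apply/rowP => s; rewrite mulmxBl -!rowE !mxE card_arc mem_arc !val_subI.
have jn := ltn_ord j; have sn := ltn_ord s; have iN := ltn_ord i.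
have [ij|ji] := leqP i j.
  rewrite natrB //.
  have -> : ((if (i <= s)%N then (s - i)%N else (s + m.+3 - i)%N) < j - i)%N =
     (i <= s < j)%N by case: (leqP i s); lia.
  case: (leqP i s) => si; last (have -> : (s < j)%N by lia).
    by case: (s < j)%N; rewrite /=; ring.
  by rewrite /=; ring.
rewrite natrB ?natrD; last by lia.
have -> : ((if (i <= s)%N then (s - i)%N else (s + m.+3 - i)%N) < j + m.+3 - i)%N =
     ~~ (j <= s < i)%N by case: (leqP i s); lia.
have n0 : m.+3%:R != 0 :> R by rewrite pnatr_eq0.
have -> : (j%:R + m.+3%:R - i%:R) / m.+3%:R = j%:R / m.+3%:R + 1 - i%:R / m.+3%:R :> R.
  by rewrite mulrBl mulrDl divff.
case: (leqP j s) => sj; last (have -> : (s < i)%N by lia); last by rewrite /=; ring.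
by case: (s < i)%N => /=; ring.
Qed.

Lemma mul_succmx (R : realFieldType) m (x : 'rV[R]_m.+3) t :
  (x *m succmx R m) 0 t = x 0 (t - 1) - x 0 t.
Proof.
rewrite mxE.
under eq_bigr => s _ do rewrite mxE mulrBr.
rewrite big_split /= sumrN; congr (_ - _).
  rewrite (bigD1 (t - 1)) //= subrK eqxx mulr1 big1 ?addr0 // => s st.
  by rewrite -subr_eq eq_sym (negbTE st) mulr0.
rewrite (bigD1 t) //= eqxx mulr1 big1 ?addr0 // => s st.
by rewrite eq_sym (negbTE st) mulr0.
Qed.

Lemma evecB_arcmxK (R : realFieldType) m (i j : 'I_m.+3) :
  (evec R i - evec R j) *m arcmx R m *m succmx R m = evec R i - evec R j.
Proof.
(* The term at t = 0 is the jump across the wrap-around. It does not depend on [u], so it cancels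
   between the rows of [i] and [j]. *)
have key (u t : 'I_m.+3) : arcmx R m u (t - 1) - arcmx R m u t = (t == u)%:R - (t == 0)%:R.
  rewrite !mxE.
  have -> (a b c : R) : a - c - (b - c) = a - b by ring.
  have un := ltn_ord u.
  have [->|t0] := eqVneq t 0.
    have -> : (((0 - 1)%R : 'I_m.+3) < u)%N = false.
      by rewrite val_subI /= !modn_small //; lia.
    rewrite eq_sym -(inj_eq val_inj) /=.
    by case: (nat_of_ord u) => [|k] /=; ring.
  rewrite subr0 val_subI1 // -(inj_eq val_inj) /=.
  have {t0} : nat_of_ord t != 0%N by rewrite -(inj_eq val_inj) in t0.
  case: (nat_of_ord t) => // k _ /=.
  by case: (ltngtP k.+1 u) => _; rewrite /= ?subrr ?subr0.
apply/rowP => t; rewrite mul_succmx mulmxBl -!rowE.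
have rowE s : (row i (arcmx R m) - row j (arcmx R m)) 0 s = arcmx R m i s - arcmx R m j s.
  by rewrite mxE [in X in X + _]mxE [in X in _ + X]mxE [in X in _ + X]mxE.
have -> : (evec R i - evec R j) 0 t = (t == i)%:R - (t == j)%:R.
  by rewrite !mxE eqxx.
have := key i t; have := key j t; rewrite !rowE.
move: (arcmx R m i (t - 1)) (arcmx R m j (t - 1)) (arcmx R m i t) (arcmx R m j t).
by move: (t == i)%:R (t == j)%:R (t == 0)%:R => *; lra.
Qed.

(** * Inequalities for the Minkowski sum of simplices *)

Lemma sum_evec {R : realFieldType} {n : nat} (P : pred 'I_n) (v : 'I_n -> R) t :
  (\sum_(i | P i) v i *: evec R i) 0 t = if P t then v t else 0.
Proof.
rewrite summxE big_mkcond (bigD1 t) //= !mxE !eqxx mulr1 big1 ?addr0 // => i it.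
by case: ifP => // _; rewrite !mxE eqxx eq_sym (negbTE it) mulr0.
Qed.

Lemma simplex_ge0 {R : realFieldType} {n : nat} {X : {set 'I_n}} {x : 'rV[R]_n} :
  simplex X x -> forall t, 0 <= x 0 t.
Proof. by move=> [w [w0 [_ ->]]] t; rewrite sum_evec; case: ifP => // /w0. Qed.

Lemma simplex_sum {R : realFieldType} {n : nat} {X A : {set 'I_n}} {x : 'rV[R]_n} :
  simplex X x -> X \subset A -> \sum_(t in A) x 0 t = 1.
Proof.
move=> [w [_ [<- ->]]] /subsetP XA.
under eq_bigr => t _ do rewrite sum_evec.
rewrite -big_mkcondr; apply: eq_bigl => t /=.
by case: (boolP (t \in X)) => [/XA|]; rewrite ?andbF // => ->.
Qed.

Lemma evec_simplex {R : realFieldType} {n : nat} {X : {set 'I_n}} (s : 'I_n) :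
  s \in X -> simplex X (evec R s).
Proof.
move=> sX; exists (fun i => (i == s)%:R); split; first by move=> i _; rewrite ler0n.
split; first by rewrite (bigD1 s) //= eqxx big1 ?addr0 // => i /andP[_ /negbTE->].
by rewrite (bigD1 s) //= eqxx scale1r big1 ?addr0 // => i /andP[_ /negbTE->]; rewrite scale0r.
Qed.

(** A summand from the simplex of X contributes exactly 1 to the coordinate sum over [A] when X is
    inside [A], and at least 0 otherwise. *)
Lemma centered_sum {R : realFieldType} {n : nat} {x : 'rV[R]_n} (A : {set 'I_n}) :
  cyclohedron_centered x ->
  #|[set X in Con n | X \subset A]|%:R <= \sum_(t in A) x 0 t + #|Con n|%:R / n%:R * #|A|%:R.
Proof.
move=> [p [pC e]].
have -> : \sum_(t in A) x 0 t + #|Con n|%:R / n%:R * #|A|%:R =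
    \sum_(X in Con n) \sum_(t in A) p X 0 t.
  rewrite exchange_big /=.
  under [RHS]eq_bigr => t _ do rewrite -summxE -e !mxE mulr1.
  by rewrite big_split /= sumr_const mulr_natr.
rewrite -sum1_card natr_sum (eq_bigl (fun X => (X \in Con n) && (X \subset A))).
  rewrite big_mkcondr ler_sum // => X XC; case: ifP => XA.
    by rewrite (simplex_sum (pC X XC) XA).
  by apply: sumr_ge0 => t _; apply: (simplex_ge0 (pC X XC)).
by move=> X; rewrite inE.
Qed.

Lemma centered_sum0 {R : realFieldType} {n : nat} {x : 'rV[R]_n} : (0 < n)%N ->
  cyclohedron_centered x -> \sum_t x 0 t = 0.
Proof.
move=> n0 [p [pC e]].
have : \sum_t (x 0 t + #|Con n|%:R / n%:R) = \sum_(X in Con n) 1.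
  rewrite -[RHS](eq_bigr _ (fun X XC => simplex_sum (pC X XC) (subsetT X))) exchange_big /=.
  rewrite [RHS](eq_bigl predT); last by move=> t; rewrite inE.
  by apply: eq_bigr => t _; rewrite -summxE -e !mxE mulr1.
rewrite big_split /= !sumr_const card_ord -[_ / _ *+ _]mulr_natr divfK; last first.
  by rewrite pnatr_eq0; lia.
by rewrite -[RHS]add0r => /addIr.
Qed.

(** * The image of [KR] is the polar *)

(** By convexity it suffices to pair each generator with a centered point. The coordinates of that
    point sum to 0, so the constant part of the projected indicator drops out and [centered_sum]
    bounds the rest by [rhoC]. *)
Lemma KR_arcmx {R : realFieldType} {m} {x : 'rV[R]_m.+3} :
  KR (rhoC R m) x -> cyclohedron_polar (x *m arcmx R m).
Proof.
move=> [w [w0 [w1 ->]]].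
have gE t : ((\sum_(p : 'I_m.+3 * 'I_m.+3 | p.1 != p.2)
      w p *: ((rhoC R m p.1 p.2)^-1 *: (evec R p.1 - evec R p.2))) *m arcmx R m) 0 t =
    \sum_(p : 'I_m.+3 * 'I_m.+3 | p.1 != p.2) w p * (rhoC R m p.1 p.2)^-1 *
      (#|carc p.1 p.2|%:R / m.+3%:R - (t \in carc p.1 p.2)%:R).
  rewrite mulmx_suml summxE; apply: eq_bigr => p _.
  by rewrite scalerA -scalemxAl evecB_arcmx !mxE.
have dotE (x' : 'I_m.+3 -> R) (p : 'I_m.+3 * 'I_m.+3) :
    \sum_t (#|carc p.1 p.2|%:R / m.+3%:R - (t \in carc p.1 p.2)%:R) * x' t =
    #|carc p.1 p.2|%:R / m.+3%:R * \sum_t x' t - \sum_(t in carc p.1 p.2) x' t.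
  under eq_bigr => t _ do rewrite mulrBl.
  rewrite big_split /= -mulr_sumr sumrN; congr (_ - _).
  rewrite [RHS]big_mkcond; apply: eq_bigr => t _.
  by case: ifP => _; rewrite ?mul1r ?mul0r.
split.
  under eq_bigr => t _ do rewrite gE.
  rewrite exchange_big big1 //= => p _.
  (* Pairing with the all-ones vector shows that each image lies in H_0. *)
  rewrite -mulr_sumr; have := dotE (fun=> 1) p.
  under eq_bigr => t _ do rewrite mulr1.
  by move=> ->; rewrite !sumr_const card_ord divfK ?subrr ?mulr0 // pnatr_eq0.
move=> x' x'C; rewrite /dotv.
under eq_bigr => t _ do rewrite gE mulr_suml.
rewrite exchange_big /= -[leRHS]w1 ler_sum // => p pp.
have rp := rhoC_gt0 (R := R) _ _ pp.
under eq_bigr => t _ do rewrite -mulrA.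
rewrite -mulr_sumr (dotE (x' 0)) (centered_sum0 _ x'C) // mulr0 sub0r.
rewrite -mulrA -[leRHS]mulr1 ler_wpM2l ?w0 // mulrC ler_pdivrMr // mul1r.
by rewrite /rhoC lerBrDr [leLHS]addrC lerBlDl; apply: centered_sum.
Qed.

(** Decomposing M - y, with M the maximum of y, writes y as a combination of projected indicators
    with weights [w]. Testing y on a suitable point of the cyclohedron bounds the total of the
    weights times [rhoC] by 1. *)
Lemma polar_KR {R : realFieldType} {m} {y : 'rV[R]_m.+3} :
  cyclohedron_polar y -> exists2 x, KR (rhoC R m) x & y = x *m arcmx R m.
Proof.
move=> [y0 yP].
have [a _ amax] : exists2 a, true & forall t, y 0 t <= y 0 a.
  by case: (arg_maxP (P := predT) (fun t => y 0 t) (i0 := ord0) isT) => a _ h; exists a => // t; apply: h.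
set M := y 0 a in amax.
have [w [w0 wt wX]] : exists w : 'I_m.+3 * 'I_m.+3 -> R, [/\ forall p, 0 <= w p,
    forall t, M - y 0 t = \sum_p w p * (t \in carc p.1 p.2)%:R &
    forall X, X \in Con m.+3 -> exists2 s, s \in X &
      M - y 0 s = \sum_p w p * (X \subset carc p.1 p.2)%:R].
  apply: (arc_decomposition (fun t => M - y 0 t)); last by exists a; rewrite subrr.
  by move=> t; rewrite subr_ge0.
have [s sP] : exists s : {set 'I_m.+3} -> 'I_m.+3, forall X, X \in Con m.+3 ->
    s X \in X /\ M - y 0 (s X) = \sum_p w p * (X \subset carc p.1 p.2)%:R.
  apply: (@fin_all_exists _ _ (fun X s => X \in Con m.+3 -> s \in X /\
    M - y 0 s = \sum_p w p * (X \subset carc p.1 p.2)%:R)) => X.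
  by case: (boolP (X \in Con m.+3)) => [/wX[s sX e]|_]; [exists s|exists ord0].
have n0 : m.+3%:R != 0 :> R by rewrite pnatr_eq0.
(* Summing the decomposition over all coordinates determines M, because those of y sum to 0. *)
have Mn : m.+3%:R * M = \sum_p w p * #|carc p.1 p.2|%:R.
  have : \sum_t (M - y 0 t) = m.+3%:R * M.
    by rewrite big_split /= sumrN y0 subr0 sumr_const card_ord mulr_natl.
  move=> <-; under eq_bigr => t _ do rewrite wt.
  rewrite exchange_big; apply: eq_bigr => p _.
  by rewrite -mulr_sumr -natr_sum -sum1_card [in RHS]big_mkcond.
have wrho : \sum_p w p * rhoC R m p.1 p.2 <= 1.
  (* Each simplex contributes a vertex at which y is maximal on X, so [x] maximizes y over the
     centered cyclohedron. *)
  pose x := \sum_(X in Con m.+3) evec R (s X) - (#|Con m.+3|%:R / m.+3%:R) *: const_mx 1.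
  have xC : cyclohedron_centered x.
    exists (fun X => evec R (s X)); split; last by rewrite subrK.
    by move=> X XC; apply: evec_simplex; case: (sP X XC).
  apply: le_trans (yP x xC).
  have -> : dotv y x = \sum_(X in Con m.+3) y 0 (s X).
    rewrite /dotv /x.
    under eq_bigr => t _ do rewrite mxE mulrDr summxE mulr_sumr.
    rewrite big_split /= exchange_big /= [X in _ + X](_ : _ = 0) ?addr0.
      apply: eq_bigr => X _; rewrite (bigD1 (s X)) //= !mxE !eqxx mulr1 big1 ?addr0 // => t ts.
      by rewrite !mxE (negbTE ts) andbF mulr0.
    under eq_bigr => t _ do rewrite !mxE mulr1.
    by rewrite -mulr_suml y0 mul0r.
  have -> : \sum_(X in Con m.+3) y 0 (s X) =
      \sum_(X in Con m.+3) (M - \sum_p w p * (X \subset carc p.1 p.2)%:R).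
    by apply: eq_bigr => X /sP[_ <-]; rewrite opprB addrC subrK.
  rewrite big_split /= sumr_const sumrN exchange_big /= -mulr_natl.
  have -> : #|Con m.+3|%:R * M = \sum_p w p * (#|Con m.+3|%:R / m.+3%:R * #|carc p.1 p.2|%:R).
    under eq_bigr => p _ do rewrite mulrCA.
    by rewrite -mulr_sumr -Mn mulrA divfK.
  rewrite -sumrB ler_sum // => p _; rewrite -mulr_sumr -mulrBr /rhoC.
  rewrite ler_wpM2l // lerB // -natr_sum ler_nat -sum1_card.
  rewrite big_mkcond [in leqRHS]big_mkcond leq_sum // => X _.
  by rewrite inE; case: (X \in _); case: (X \subset _).
pose u := (0, 1) : 'I_m.+3 * 'I_m.+3; pose v := (1, 0) : 'I_m.+3 * 'I_m.+3.
have r01 : 0 < rhoC R m 0 1 by apply: rhoC_gt0.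
have r10 : 0 < rhoC R m 1 0 by apply: rhoC_gt0.
(* The slack 1 - sum w rho is absorbed by a multiple of the zero vector
   (e_0 - e_1) + (e_1 - e_0). *)
pose d := (1 - \sum_p w p * rhoC R m p.1 p.2) / (rhoC R m 0 1 + rhoC R m 1 0).
have d0 : 0 <= d by apply: divr_ge0; [rewrite subr_ge0|apply: addr_ge0; apply: rhoC_ge0].
pose w' p := w p + d * (p == u)%:R + d * (p == v)%:R.
have w'0 p : 0 <= w' p by apply: addr_ge0; [apply: addr_ge0|]; rewrite ?w0 //; apply: mulr_ge0; rewrite ?ler0n.
have w'E (V : lmodType R) (F : 'I_m.+3 * 'I_m.+3 -> V) :
    \sum_p w' p *: F p = \sum_p w p *: F p + d *: (F u + F v).
  have sumd q : \sum_p (d * (p == q)%:R) *: F p = d *: F q.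
    rewrite (bigD1 q) //= eqxx mulr1 big1 ?addr0 // => p /negbTE->.
    by rewrite mulr0 scale0r.
  rewrite scalerDr addrA -!sumd -!big_split /=.
  by apply: eq_bigr => p _; rewrite !scalerDl.
(* [w] may charge diagonal pairs, but both [rhoC] and e_i - e_i vanish there. *)
have offdiag (V : zmodType) (F : 'I_m.+3 * 'I_m.+3 -> V) : (forall i, F (i, i) = 0) ->
    \sum_(p | p.1 != p.2) F p = \sum_p F p.
  move=> F0; rewrite big_mkcond; apply: eq_bigr => -[i j] _ /=.
  by case: eqP => // ->; rewrite F0.
exists (\sum_p w' p *: (evec R p.1 - evec R p.2)).
  exists (fun p => w' p * rhoC R m p.1 p.2); split; last split.
  - by move=> p _; rewrite mulr_ge0 ?rhoC_ge0.
  - rewrite offdiag; last by move=> i; rewrite rhoC_diag mulr0.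
    rewrite (w'E R^o (fun p => rhoC R m p.1 p.2)) /=.
    have rr : rhoC R m 0 1 + rhoC R m 1 0 != 0 by apply: lt0r_neq0; apply: addr_gt0.
    transitivity ((\sum_p w p * rhoC R m p.1 p.2) + d * (rhoC R m 0 1 + rhoC R m 1 0)).
      by [].
    by rewrite /d (divfK rr) addrC subrK.
  - rewrite -offdiag; last by move=> i; rewrite subrr scaler0.
    apply: eq_bigr => p pp; rewrite !scalerA mulfK //.
    by rewrite gt_eqF // rhoC_gt0.
rewrite w'E /= -[evec R 0 - evec R 1]opprB addNr scaler0 addr0.
apply/rowP => t; rewrite mulmx_suml summxE.
under eq_bigr => p _ do rewrite -scalemxAl evecB_arcmx !mxE mulrBr mulrA.
(* The two sums are M and M - y_t. *)
by rewrite sumrB -mulr_suml -Mn -wt mulrC mulKf // opprB addrC subrK.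
Qed.

Theorem mainTheorem12 (R : realFieldType) (n : nat) (hn : (3 <= n)%N) :
  exists rho : 'I_n -> 'I_n -> R,
    [/\ quasi_metric rho,
        affinely_isomorphic (KR rho) (@cyclohedron_polar R n) &
        (forall i j k : 'I_n, i != j -> j != k -> i != k ->
           rho i k < rho i j + rho j k)].
Proof.
case: n hn => [|[|[|m]]] // _.
exists (rhoC R m); split; first exact: rhoC_quasi_metric.
  have KRK x : KR (rhoC R m) x -> x *m arcmx R m *m succmx R m = x.
    move=> [w [_ [_ ->]]]; rewrite !mulmx_suml; apply: eq_bigr => p _.
    by rewrite -!scalemxAl evecB_arcmxK.
  exists (fun x => x *m arcmx R m + 0), (fun y => y *m succmx R m + 0).
  split; first by exists (arcmx R m), 0.
  split; first by exists (succmx R m), 0.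
  split; first by move=> x xKR; rewrite addr0; apply: KR_arcmx.
  split; first by move=> y /polar_KR[x xKR ->]; rewrite addr0 KRK.
  split; first by move=> x xKR; rewrite !addr0 KRK.
  (* Every y in the polar is an image under [arcmx], so the one-sided inverse identity on [KR]
     suffices in this direction too. *)
  by move=> y /polar_KR[x xKR ->]; rewrite !addr0 KRK.
by move=> i j k ij jk _; apply: rhoC_triangle.
Qed.
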